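(* There is a universal constant $C>0$ such that for all positive integers $N,M$, every subset $\mathcal{Z}\subseteq\{0,1\}^N\times\{0,1\}^M$ and every Boolean function $f:\mathcal{Z}\to\{0,1\}$ (partial or total), $\mathrm{R}^1(f)\le C\cdot M\cdot\mathrm{Q}^1(f)$; i.e., $\mathrm{R}^1(f)=O(M\,\mathrm{Q}^1(f))$, where $M$ is the length of Bob's input.
   Context: One-way communication: Alice holds $x\in\{0,1\}^N$, Bob holds $y\in\{0,1\}^M$, with $(x,y)\in\mathcal{Z}$ (if $\mathcal{Z}=\{0,1\}^N\times\{0,1\}^M$, $f$ is total, otherwise partial). Alice sends a single message to Bob, and Bob must output $f(x,y)$; there is no communication from Bob to Alice. $\mathrm{R}^1(f)$ is the minimum $k$ such that there is a protocol in which Alice sends a $k$-bit string drawn from a distribution $\mathcal{D}_x$ depending only on $x$, and Bob (as a function of the message and $y$) outputs $f(x,y)$ with probability at least $2/3$ for every $(x,y)\in\mathcal{Z}$. $\mathrm{Q}^1(f)$ is the minimum $k$ such that Alice can send a $k$-qubit mixed state $\rho_x$ depending only on $x$, and Bob, by applying a measurement depending on $y$, outputs $f(x,y)$ with probability at least $2/3$ for every $(x,y)\in\mathcal{Z}$. *)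

(* Defs.v *)
From HB Require Import structures.
From mathcomp Require Import all_boot all_order all_algebra.
From mathcomp Require Import boolp.
From mathcomp Require Import Rstruct.
From mathcomp Require Import complex.
From Stdlib Require Rdefinitions.

Set Implicit Arguments.
Unset Strict Implicit.
Unset Printing Implicit Defensive.

Import Order.TTheory GRing.Theory Num.Theory.
Local Open Scope ring_scope.

Notation Real := Rdefinitions.R.
Notation Cplx := (Real[i]).

Definition bits (n : nat) := {ffun 'I_n -> bool}.

Definition is_distr (T : finType) (p : T -> Real) : Prop :=
  (forall t, 0 <= p t) /\ \sum_(t : T) p t = 1.

(* A partial Boolean function f : Z -> {0,1} with Z a subset of
   {0,1}^N x {0,1}^M is represented by its domain Z together with any
   total extension f : {0,1}^N -> {0,1}^M -> bool; only the values on Z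
   are ever used. *)

Definition R1_protocol (N M : nat) (Z : {set bits N * bits M})
    (f : bits N -> bits M -> bool) (k : nat) : Prop :=
  exists (D : bits N -> bits k -> Real) (out : bits k -> bits M -> bool),
    (forall x, is_distr (D x)) /\
    (forall x y, (x, y) \in Z ->
       2 / 3 <= \sum_(m : bits k | out m y == f x y) D x m).

Definition adjmx (n : nat) (A : 'M[Cplx]_n) : 'M[Cplx]_n := map_mx Num.conj (A^T).

Definition psdmx (n : nat) (A : 'M[Cplx]_n) : Prop :=
  adjmx A = A /\
  forall v : 'cV[Cplx]_n, 0 <= ((map_mx Num.conj v^T) *m A *m v) 0 0.

Definition density (n : nat) (rho : 'M[Cplx]_n) : Prop :=
  psdmx rho /\ \tr rho = 1.

Definition povm (n : nat) (E : bool -> 'M[Cplx]_n) : Prop :=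
  (forall b, psdmx (E b)) /\ E false + E true = 1%:M.

(* One-way quantum protocol with k-qubit messages (states on C^(2^k)):
   Alice sends rho_x, Bob measures with a y-dependent measurement and outputs
   the outcome; the probability of outcome b is tr(E_y(b) rho_x). *)
Definition Q1_protocol (N M : nat) (Z : {set bits N * bits M})
    (f : bits N -> bits M -> bool) (k : nat) : Prop :=
  exists (rho : bits N -> 'M[Cplx]_(2 ^ k)) (E : bits M -> bool -> 'M[Cplx]_(2 ^ k)),
    (forall x, density (rho x)) /\
    (forall y, povm (E y)) /\
    (forall x y, (x, y) \in Z -> (2 / 3 : Cplx) <= \tr (E y (f x y) *m rho x)).

(* R^1(f) and Q^1(f): the minimum message length (0 if no protocol existed,
   which never happens). *)
Definition R1 (N M : nat) (Z : {set bits N * bits M})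
    (f : bits N -> bits M -> bool) : nat :=
  match pselect (exists k, `[< R1_protocol Z f k >]) with
  | left H => ex_minn H
  | right _ => 0%N
  end.

Definition Q1 (N M : nat) (Z : {set bits N * bits M})
    (f : bits N -> bits M -> bool) : nat :=
  match pselect (exists k, `[< Q1_protocol Z f k >]) with
  | left H => ex_minn H
  | right _ => 0%N
  end.

(* Main.v *)
(* Bob keeps a hypothesis state: a near-minimiser of tr(X ln X), X = sigma + 1/n,
   n = 2^k, among the density matrices that answer correctly, with probability at
   least 2/3, on the labelled inputs (y, f(x,y)) received so far. Alice's message is
   a list of inputs on each of which the hypothesis built from the others before it
   errs. Such a mistake moves the hypothesis by a constant in the direction of one
   measurement operator, and the potential is uniformly midpoint convex along such
   directions, so it grows by at least 1/1152 at every mistake. As its range has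
   length 2 ln n <= 2k, at most 2304 k mistakes are made, and a deterministic
   message of O(M k) bits suffices.

   The convexity is obtained without matrix calculus: the divergence of A from B is
   sum_ij |w_ij|^2 d(a_i, b_j) for the scalar divergence d of x ln x, the eigenvalues
   a_i, b_j and the eigenbasis overlaps w_ij, while
   tr((A - B) P) = sum_ij (a_i - b_j) w_ij q_ji;
   AM-GM with d(a, b) >= (a - b)^2 / (2 (a + b)) compares the two. *)

Require Import Defs.
From mathcomp Require Import all_boot all_order all_algebra.
From mathcomp Require Import Rstruct.
From mathcomp Require Import boolp complex spectral.
From mathcomp Require Import ring lra zify.
From Stdlib Require Rpower.

Import Order.TTheory GRing.Theory Num.Theory.
Local Open Scope ring_scope.

Set Implicit Arguments.
Unset Strict Implicit.
Unset Printing Implicit Defensive.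

Local Notation ln := (Rpower.ln : Real -> Real).
Local Notation Re := complex.Re.
Local Notation Im := complex.Im.

(** * The logarithm and the scalar divergence of x ln x *)

Lemma lnRM (x y : Real) : 0 < x -> 0 < y -> ln (x * y) = ln x + ln y.
Proof. by move=> /RltP x0 /RltP y0; exact: Rpower.ln_mult. Qed.

Lemma ln_le_sub1 (x : Real) : 0 < x -> ln x <= x - 1.
Proof.
move=> /RltP x0; have /RleP := Rpower.exp_ineq1_le (ln x).
by rewrite Rpower.exp_ln // lerBrDl.
Qed.

Lemma lnR1 : ln 1 = 0.
Proof. by have := @lnRM 1 1 ltr01 ltr01; rewrite mulr1; lra. Qed.

Lemma lnRV (x : Real) : 0 < x -> ln x^-1 = - ln x.
Proof.
move=> x0; have := @lnRM x x^-1 x0; rewrite invr_gt0 => /(_ x0).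
by rewrite mulfV ?gt_eqF // lnR1; lra.
Qed.

Lemma ln_le (x y : Real) : 0 < x -> x <= y -> ln x <= ln y.
Proof.
move=> x0 xy; have y0 : 0 < y by exact: lt_le_trans xy.
have : ln (x / y) <= x / y - 1 by apply: ln_le_sub1; rewrite divr_gt0.
rewrite lnRM ?invr_gt0 // lnRV //.
have : x / y <= 1 by rewrite ler_pdivrMr ?mul1r.
lra.
Qed.

Lemma ln_pow2_le (k : nat) : ln (2 ^ k)%:R <= k%:R.
Proof.
have l2 : ln 2 <= 1 by have := @ln_le_sub1 2 (ltr0n _ 2); lra.
elim: k => [|k IH]; first by rewrite expn0 lnR1.
have p0 : 0 < (2 ^ k)%:R :> Real by rewrite ltr0n expn_gt0.
rewrite expnS natrM lnRM //.
by rewrite -addn1 natrD; lra.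
Qed.

Definition xlnx (x : Real) : Real := x * ln x.

(** With a = p^2 and b = q^2, the bound ln (q/p) <= q/p - 1 makes the tangent gap at least (p -
    q)^2; then (p + q)^2 <= 2 (p^2 + q^2) finishes. No second derivative is involved. *)
Lemma xlnx_tangent_gap (a b : Real) : 0 < a -> 0 < b ->
  (a - b) ^+ 2 <= 2 * (a + b) * (xlnx a - xlnx b - (ln b + 1) * (a - b)).
Proof.
move=> a0 b0; rewrite /xlnx.
set p := Num.sqrt a; set q := Num.sqrt b.
have p0 : 0 < p by rewrite sqrtr_gt0.
have q0 : 0 < q by rewrite sqrtr_gt0.
have Ea : a = p * p by rewrite -expr2 sqr_sqrtr // ltW.
have Eb : b = q * q by rewrite -expr2 sqr_sqrtr // ltW.
have : ln (q / p) <= q / p - 1 by apply: ln_le_sub1; rewrite divr_gt0.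
rewrite lnRM ?invr_gt0 // lnRV // => H.
have H1 : p * p * (ln q - ln p) <= p * q - p * p.
  have -> : p * q - p * p = p * p * (q / p - 1).
    by field; rewrite gt_eqF.
  by rewrite ler_pM2l ?mulr_gt0.
rewrite Ea Eb !lnRM //.
have H2 : (p - q) ^+ 2 <= p * p * (ln p + ln p) - q * q * (ln q + ln q) -
   (ln q + ln q + 1) * (p * p - q * q).
  rewrite expr2; lra.
have H3 : (p * p - q * q) ^+ 2 <= 2 * (p * p + q * q) * (p - q) ^+ 2.
  have -> : 2 * (p * p + q * q) * (p - q) ^+ 2 =
    (p * p - q * q) ^+ 2 + ((p - q) ^+ 2) ^+ 2 by ring.
  by rewrite lerDl sqr_ge0.
apply: le_trans H3 _; rewrite ler_pM2l // mulr_gt0 ?ltr0n //.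
by rewrite addr_gt0 ?mulr_gt0.
Qed.

(** The left side is the tangent to x ln x at c, evaluated at a. *)
Lemma xlnx_ge_tangent (a c : Real) : 0 < a -> 0 < c -> a * ln c + a - c <= xlnx a.
Proof.
move=> a0 c0; have ac : 0 < 2 * (a + c) by rewrite mulr_gt0 ?ltr0n ?addr_gt0.
have := le_trans (sqr_ge0 _) (@xlnx_tangent_gap a c a0 c0).
by rewrite pmulr_rge0 // /xlnx; lra.
Qed.

Definition sqn (z : Cplx) : Real := Re z ^+ 2 + Im z ^+ 2.

(* AM-GM applied to the real and imaginary parts of u and v. *)
Lemma cross_term_le (a b s : Real) (u v : Cplx) : 0 < a -> 0 < b ->
  2 * s * ((a - b) * Re (u * v)) <=
  2 * (sqn u * (xlnx a - xlnx b - (ln b + 1) * (a - b))) +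
  s ^+ 2 * (sqn v * (a + b)).
Proof.
move=> a0 b0; have ab : 0 < a + b by rewrite addr_gt0.
have := @xlnx_tangent_gap a b a0 b0.
set K := _ - _ - _ => HK.
rewrite /sqn; case: u v => [x y] [z t] /=.
rewrite -(ler_pM2l ab).
have : (x ^+ 2 + y ^+ 2) * (a - b) ^+ 2 <= (x ^+ 2 + y ^+ 2) * (2 * (a + b) * K).
  by rewrite ler_wpM2l // addr_ge0 ?sqr_ge0.
have := sqr_ge0 ((a - b) * x - s * (a + b) * z).
have := sqr_ge0 ((a - b) * y + s * (a + b) * t).
nra.
Qed.

(** * Real parts, adjoints and positive semidefinite matrices *)

Lemma ReD (x y : Cplx) : Re (x + y) = Re x + Re y.
Proof. by case: x y => [a b] [c d]. Qed.

Lemma ReB (x y : Cplx) : Re (x - y) = Re x - Re y.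
Proof. by case: x y => [a b] [c d]. Qed.

Lemma Re_sum (I : finType) (F : I -> Cplx) : Re (\sum_i F i) = \sum_i Re (F i).
Proof. by apply: (big_ind2 (fun z r => Re z = r)) => // ? ? ? ? <- <-; exact: ReD. Qed.

Lemma Re_scale (r : Real) (x : Cplx) : Re (r%:C%C * x) = r * Re x.
Proof. by case: x => [a b] /=; rewrite mul0r subr0. Qed.

Lemma le_Re (x y : Cplx) : x <= y -> Re x <= Re y.
Proof. by rewrite lecE => /andP[]. Qed.

Lemma sqnE (z : Cplx) : (sqn z)%:C%C = z * Num.conj z.
Proof. by rewrite /sqn add_Re2_Im2 normCK. Qed.

Lemma sqn_conj (z : Cplx) : sqn (Num.conj z) = sqn z.
Proof. by apply: complexI; rewrite !sqnE conjCK mulrC. Qed.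

Lemma adjmxK n (A : 'M[Cplx]_n) : adjmx (adjmx A) = A.
Proof. exact: trmxCK. Qed.

Lemma adjmxM n (A B : 'M[Cplx]_n) : adjmx (A *m B) = adjmx B *m adjmx A.
Proof. by rewrite /adjmx trmx_mul map_mxM. Qed.

Lemma adjmxD n (A B : 'M[Cplx]_n) : adjmx (A + B) = adjmx A + adjmx B.
Proof. by rewrite /adjmx linearD /= map_mxD. Qed.

Lemma adjmxZ n (r : Real) (A : 'M[Cplx]_n) :
  adjmx (r%:C%C *: A) = r%:C%C *: adjmx A.
Proof.
rewrite /adjmx linearZ /= map_mxZ; congr (_ *: _).
by apply/CrealP; apply/complex_realP; exists r.
Qed.

Lemma adjmx1 n : adjmx (1%:M : 'M[Cplx]_n) = 1%:M.
Proof. by rewrite /adjmx trmx1 map_mx1. Qed.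

Lemma psdmx_congr n (X A : 'M[Cplx]_n) : psdmx A -> psdmx (X *m A *m adjmx X).
Proof.
case=> hA pA; split; first by rewrite !adjmxM adjmxK hA !mulmxA.
move=> v; have := pA (adjmx X *m v).
by rewrite trmx_mul map_mxM [map_mx _ (adjmx X)^T]adjmxK !mulmxA.
Qed.

Lemma psdmx_diag_ge0 n (A : 'M[Cplx]_n) i : psdmx A -> 0 <= A i i.
Proof.
case=> _ /(_ (delta_mx i 0)); rewrite trmx_delta map_delta_mx.
by rewrite -rowE -colE !mxE.
Qed.

Lemma psdmxD n (A B : 'M[Cplx]_n) : psdmx A -> psdmx B -> psdmx (A + B).
Proof.
move=> [hA pA] [hB pB]; split; first by rewrite adjmxD hA hB.
by move=> v; rewrite mulmxDr mulmxDl mxE addr_ge0.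
Qed.

Lemma psdmxZ n (r : Real) (A : 'M[Cplx]_n) : 0 <= r -> psdmx A -> psdmx (r%:C%C *: A).
Proof.
move=> r0 [hA pA]; split; first by rewrite adjmxZ hA.
by move=> v; rewrite -scalemxAr -scalemxAl mxE mulr_ge0 // ler0c.
Qed.

Lemma psdmx1 n : psdmx (1%:M : 'M[Cplx]_n).
Proof.
split; first exact: adjmx1.
move=> v; rewrite mulmx1 mxE sumr_ge0 // => i _.
by rewrite !mxE mulrC mul_conjC_ge0.
Qed.

Definition dgmx n (a : 'I_n -> Real) : 'M[Cplx]_n := diag_mx (\row_i (a i)%:C%C).

Lemma dgmx1 n : dgmx (fun _ : 'I_n => 1) = 1%:M.
Proof. by rewrite /dgmx -diag_const_mx; congr diag_mx; apply/rowP=> i; rewrite !mxE. Qed.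

Lemma mul_dgmx n (a : 'I_n -> Real) (X : 'M[Cplx]_n) i j :
  (dgmx a *m X) i j = (a i)%:C%C * X i j.
Proof. by rewrite /dgmx mul_diag_mx !mxE. Qed.

Lemma mul_mx_dgmx n (a : 'I_n -> Real) (X : 'M[Cplx]_n) i j :
  (X *m dgmx a) i j = X i j * (a j)%:C%C.
Proof. by rewrite /dgmx mul_mx_diag !mxE. Qed.

(** W is later the overlap matrix of two eigenbases, or a measurement operator written between
    them. *)
Lemma mxtrace_dgmx2 n (g a : 'I_n -> Real) (W : 'M[Cplx]_n) :
  \tr (dgmx g *m W *m dgmx a *m adjmx W) =
  (\sum_i \sum_j sqn (W i j) * (g i * a j))%:C%C.
Proof.
rewrite /mxtrace rmorph_sum /=; apply: eq_bigr => i _.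
rewrite mxE rmorph_sum /=; apply: eq_bigr => j _.
rewrite mul_mx_dgmx mul_dgmx !mxE !rmorphM /= sqnE; ring.
Qed.

Lemma sum_sqn_row n (W : 'M[Cplx]_n) i :
  W *m adjmx W = 1%:M -> \sum_j sqn (W i j) = 1.
Proof.
move/matrixP/(_ i i); rewrite !mxE eqxx => E.
apply: complexI; rewrite rmorph_sum /= -[RHS]E.
by apply: eq_bigr => j _; rewrite !mxE sqnE.
Qed.

Lemma sum_sqn_col n (W : 'M[Cplx]_n) j :
  adjmx W *m W = 1%:M -> \sum_i sqn (W i j) = 1.
Proof.
move=> H; rewrite -(@sum_sqn_row n (adjmx W) j) ?adjmxK //.
by apply: eq_bigr => i _; rewrite !mxE sqn_conj.
Qed.

(** * Spectral decomposition and measurement operators *)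

(** [spectral_diag] is complex-valued; its entries are real for Hermitian A, so the real part loses
    nothing there. *)
Definition eigval n (A : 'M[Cplx]_n) (i : 'I_n) : Real := Re (spectral_diag A 0 i).

Lemma adj_spectralmx n (A : 'M[Cplx]_n) :
  spectralmx A *m adjmx (spectralmx A) = 1%:M /\
  adjmx (spectralmx A) *m spectralmx A = 1%:M.
Proof.
have H : spectralmx A *m adjmx (spectralmx A) = 1%:M.
  exact: (unitarymxP (spectral_unitarymx A)).
by split=> //; apply: mulmx1C.
Qed.

Lemma hermitian_spectral n (A : 'M[Cplx]_n) : adjmx A = A ->
  A = adjmx (spectralmx A) *m dgmx (eigval A) *m spectralmx A.
Proof.
move=> hA; have hs : A \is hermsymmx.
  by apply/is_hermitianmxP; rewrite expr0 scale1r; exact: (esym hA).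
have /orthomx_spectralP E := hermitian_normalmx hs.
have D : diag_mx (spectral_diag A) = dgmx (eigval A).
  rewrite /dgmx; congr diag_mx; apply/rowP=> i; rewrite mxE.
  have /mxOverP/(_ 0 i) := hermitian_spectral_diag_real hs.
  by move/RRe_real.
by rewrite [LHS]E D (invmx_unitary (spectral_unitarymx A)).
Qed.

Lemma spectral_dgmx n (A : 'M[Cplx]_n) : adjmx A = A ->
  spectralmx A *m A *m adjmx (spectralmx A) = dgmx (eigval A).
Proof.
move/hermitian_spectral=> {2}->; have [UU _] := adj_spectralmx A.
by rewrite !mulmxA UU mul1mx -mulmxA UU mulmx1.
Qed.

Lemma mxtrace_eigval n (A : 'M[Cplx]_n) : adjmx A = A ->
  \tr A = (\sum_i eigval A i)%:C%C.
Proof.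
move/spectral_dgmx/(congr1 mxtrace).
rewrite mxtrace_mulC mulmxA; have [_ ->] := adj_spectralmx A; rewrite mul1mx => ->.
by rewrite /dgmx mxtrace_diag rmorph_sum; apply: eq_bigr => i _; rewrite mxE.
Qed.

Lemma eigval_ge0 n (A : 'M[Cplx]_n) i : psdmx A -> 0 <= eigval A i.
Proof.
move=> pA; have := psdmx_diag_ge0 i (psdmx_congr (spectralmx A) pA).
by rewrite spectral_dgmx ?pA.1 // /dgmx !mxE eqxx mulr1n ler0c.
Qed.

(** In the eigenbasis of B the trace is a sum of diagonal entries of A times eigenvalues of B, all
    nonnegative. *)
Lemma mxtrace_psd_mul_ge0 n (A B : 'M[Cplx]_n) :
  psdmx A -> psdmx B -> 0 <= \tr (A *m B).
Proof.
move=> pA pB; rewrite (hermitian_spectral pB.1) !mulmxA mxtrace_mulC !mulmxA.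
set U := spectralmx B; rewrite /mxtrace sumr_ge0 // => i _.
rewrite mul_mx_dgmx mulr_ge0 ?ler0c ?eigval_ge0 //.
exact/psdmx_diag_ge0/psdmx_congr.
Qed.

Definition effect n (P : 'M[Cplx]_n) := psdmx P /\ psdmx (1%:M - P).

Lemma effect_trace_le n (P A : 'M[Cplx]_n) : effect P -> psdmx A ->
  \tr (P *m A) <= \tr A.
Proof.
case=> _ pQ pA; have := mxtrace_psd_mul_ge0 pQ pA.
by rewrite mulmxBl mul1mx linearB /= subr_ge0.
Qed.

(* P - P ^ 2 = P (1 - P) P + (1 - P) P (1 - P) is positive semidefinite. *)
Lemma effect_sqr_trace_le n (P A : 'M[Cplx]_n) : effect P -> psdmx A ->
  \tr (P *m A *m P) <= \tr A.
Proof.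
move=> eP pA; apply: le_trans (effect_trace_le eP pA).
have [pP pQ] := eP.
have := mxtrace_psd_mul_ge0 (psdmxD (psdmx_congr P pQ) (psdmx_congr (1%:M - P) pP)) pA.
have -> : P *m (1%:M - P) *m adjmx P + (1%:M - P) *m P *m adjmx (1%:M - P) =
          P - P *m P.
  have PQ : P *m (1%:M - P) = P - P *m P by rewrite mulmxBr mulmx1.
  have QP : (1%:M - P) *m P = P - P *m P by rewrite mulmxBl mul1mx.
  by rewrite pP.1 pQ.1 QP -PQ -mulmxDr [P + _]addrC subrK mulmx1.
by rewrite mulmxBl linearB /= subr_ge0 [\tr (P *m A *m P)]mxtrace_mulC mulmxA.
Qed.

(** * Matrix entropy and its divergence *)

(** This is tr(A ln A), the negative of the von Neumann entropy, hence convex. *)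
Definition entropy n (A : 'M[Cplx]_n) : Real := \sum_i xlnx (eigval A i).

(** ln B + 1, the gradient of tr(B ln B), assembled in the eigenbasis of B. *)
Definition entropy_grad n (B : 'M[Cplx]_n) : 'M[Cplx]_n :=
  adjmx (spectralmx B) *m dgmx (fun j => ln (eigval B j) + 1) *m spectralmx B.

Definition posdef n (A : 'M[Cplx]_n) := psdmx A /\ forall i, 0 < eigval A i.

Section Divergence.

Variables (n : nat) (U V A B : 'M[Cplx]_n) (a b : 'I_n -> Real).
Hypotheses (UU : U *m adjmx U = 1%:M) (VV : V *m adjmx V = 1%:M).
Hypotheses (defA : A = adjmx U *m dgmx a *m U).
Hypotheses (defB : B = adjmx V *m dgmx b *m V).

(** W i j is the overlap of the i-th eigenvector of A with the j-th of B. Unitarity makes the matrix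
    of all [sqn (W i j)] doubly stochastic. *)
Local Notation W := (U *m adjmx V).

Let UU' : adjmx U *m U = 1%:M. Proof. exact: mulmx1C. Qed.
Let VV' : adjmx V *m V = 1%:M. Proof. exact: mulmx1C. Qed.

Let WW : W *m adjmx W = 1%:M.
Proof. by rewrite adjmxM adjmxK !mulmxA -[U *m _ *m V]mulmxA VV' mulmx1 UU. Qed.

Let WW' : adjmx W *m W = 1%:M.
Proof. exact: mulmx1C. Qed.

Let sum_overlap_l (F : 'I_n -> Real) :
  \sum_i \sum_j sqn (W i j) * F i = \sum_i F i.
Proof. by apply: eq_bigr => i _; rewrite -big_distrl /= sum_sqn_row // mul1r. Qed.

Let sum_overlap_r (F : 'I_n -> Real) :
  \sum_i \sum_j sqn (W i j) * F j = \sum_j F j.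
Proof.
rewrite exchange_big /=.
by apply: eq_bigr => i _; rewrite -big_distrl /= sum_sqn_col // mul1r.
Qed.

(** The squared overlaps have row and column sums 1, so sums over one spectrum can be spread over
    all pairs (i, j), where they join tr(g(B) A), already a double sum. *)
Lemma divergence_overlap (phi g : Real -> Real) :
  \sum_i phi (a i) - \sum_j phi (b j) -
    Re (\tr (adjmx V *m dgmx (g \o b) *m V *m (A - B))) =
  \sum_i \sum_j sqn (W i j) * (phi (a i) - phi (b j) - g (b j) * (a i - b j)).
Proof.
have EA : \tr (adjmx V *m dgmx (g \o b) *m V *m A) =
    (\sum_i \sum_j sqn (W i j) * (a i * g (b j)))%:C%C.
  rewrite -(mxtrace_dgmx2 a (g \o b)) adjmxM adjmxK defA [RHS]mxtrace_mulC.
  by rewrite -!mulmxA [LHS]mxtrace_mulC -!mulmxA [LHS]mxtrace_mulC !mulmxA.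
have EB : \tr (adjmx V *m dgmx (g \o b) *m V *m B) = (\sum_j g (b j) * b j)%:C%C.
  rewrite defB !mulmxA mxtrace_mulC !mulmxA VV mul1mx -[_ *m V *m _]mulmxA VV mulmx1.
  rewrite /mxtrace rmorph_sum; apply: eq_bigr => j _.
  by rewrite mul_dgmx /dgmx !mxE eqxx mulr1n rmorphM.
rewrite mulmxBr linearB /= ReB EA EB /=.
rewrite -(sum_overlap_l (phi \o a)) -(sum_overlap_r (phi \o b)).
rewrite -(sum_overlap_r (fun j => g (b j) * b j)).
rewrite -!sumrB; apply: eq_bigr => i _; rewrite -!sumrB; apply: eq_bigr => j _ /=.
ring.
Qed.

Variable P : 'M[Cplx]_n.
Local Notation Q := (V *m P *m adjmx U).

(** Q writes P as a map from the eigenbasis of A to that of B. Inserting both bases in both traces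
    gives a_i and b_j the same weight W_ij Q_ji. *)
Lemma mxtrace_diff_overlap :
  Re (\tr ((A - B) *m P)) = \sum_i \sum_j (a i - b j) * Re (W i j * Q j i).
Proof.
have EA : \tr (A *m P) = \tr (dgmx a *m (W *m Q)).
  rewrite defA -!mulmxA mxtrace_mulC.
  by rewrite !mulmxA -[_ *m adjmx V *m V]mulmxA VV' mulmx1.
have EB : \tr (B *m P) = \tr (W *m dgmx b *m Q).
  by rewrite defB !mulmxA [RHS]mxtrace_mulC !mulmxA UU' mul1mx.
rewrite mulmxBl linearB /= EA EB ReB /mxtrace !Re_sum -sumrB.
apply: eq_bigr => i _; rewrite mul_dgmx [(W *m Q) i i]mxE.
rewrite [(W *m dgmx b *m Q) i i]mxE big_distrr /= !Re_sum -sumrB.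
apply: eq_bigr => j _; rewrite mul_mx_dgmx -ReB.
by rewrite -Re_scale rmorphB; congr complex.Re; ring.
Qed.

(** The double sum is tr(P A P) + tr(P B P), and [effect_sqr_trace_le] bounds each term. This
    controls the quadratic term of the AM-GM step. *)
Lemma effect_overlap_le : effect P -> psdmx A -> psdmx B ->
  \sum_i \sum_j sqn (Q j i) * (a i + b j) <= Re (\tr A + \tr B).
Proof.
move=> eP pA pB.
have EA : \tr (P *m A *m P) = (\sum_i \sum_j sqn (Q j i) * a i)%:C%C.
  transitivity (\sum_j \sum_i sqn (Q j i) * (1 * a i))%:C%C; last first.
    congr (_%:C%C); rewrite exchange_big /=.
    by do 2![apply: eq_bigr => ? _]; rewrite mul1r.
  rewrite -mxtrace_dgmx2 dgmx1 mul1mx !adjmxM adjmxK eP.1.1 defA.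
  by rewrite !mulmxA [RHS]mxtrace_mulC !mulmxA VV' mul1mx.
have EB : \tr (P *m B *m P) = (\sum_i \sum_j sqn (Q j i) * b j)%:C%C.
  transitivity (\sum_j \sum_i sqn (Q j i) * (b j * 1))%:C%C; last first.
    congr (_%:C%C); rewrite exchange_big /=.
    by do 2![apply: eq_bigr => ? _]; rewrite mulr1.
  rewrite -mxtrace_dgmx2 dgmx1 mulmx1 !adjmxM adjmxK eP.1.1 defB.
  rewrite !mulmxA -[_ *m adjmx U *m U]mulmxA UU' mulmx1.
  by rewrite -!mulmxA [LHS]mxtrace_mulC !mulmxA [RHS]mxtrace_mulC !mulmxA.
rewrite ReD.
have := le_Re (effect_sqr_trace_le eP pA); rewrite EA /= => HA.
have := le_Re (effect_sqr_trace_le eP pB); rewrite EB /= => HB.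
apply: le_trans (lerD HA HB); rewrite -big_split /= ler_sum // => i _.
by rewrite -big_split /= ler_sum // => j _; rewrite mulrDr.
Qed.

End Divergence.

(** A Pinsker-type inequality, obtained by summing [cross_term_le] over all pairs of eigenvalues.
    Trace 2 is that of a regularized state. *)
Lemma divergence_ge n (A B P : 'M[Cplx]_n) :
  posdef A -> posdef B -> \tr A = 2 -> \tr B = 2 -> effect P ->
  Re (\tr ((A - B) *m P)) ^+ 2 / 8 <=
  entropy A - entropy B - Re (\tr (entropy_grad B *m (A - B))).
Proof.
move=> [pA a0] [pB b0] tA tB eP.
have [UU _] := adj_spectralmx A; have [VV _] := adj_spectralmx B.
have dA := hermitian_spectral pA.1; have dB := hermitian_spectral pB.1.
have := divergence_overlap UU VV dA dB xlnx (fun x => ln x + 1).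
rewrite -/(entropy A) -/(entropy B) -/(entropy_grad B) => ->.
have := effect_overlap_le UU VV dA dB eP pA pB; rewrite tA tB.
have := mxtrace_diff_overlap UU VV dA dB P.
(* With S <= 4 the summed inequality reads 2 s t - 4 s^2 <= 2 D; the choice s = t/4 maximizes its
   left side and gives D >= t^2/8. *)
set t := Re _ => E; set S := \sum_i _ => HS; set D := \sum_i _; pose s := t / 4.
have : 2 * s * t <= 2 * D + s ^+ 2 * S.
  rewrite E /D /S !mulr_sumr -big_split /= ler_sum // => i _.
  rewrite !mulr_sumr -big_split /= ler_sum // => j _.
  exact: cross_term_le.
have S4 : S <= 4 by apply: le_trans HS _; rewrite ReD /=; lra.
have : s ^+ 2 * S <= s ^+ 2 * 4 by rewrite ler_wpM2l ?sqr_ge0.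
rewrite /s !expr2; nra.
Qed.

(* The gradient terms of the two divergences to the midpoint cancel. *)
Lemma entropy_midpoint n (A B M P : 'M[Cplx]_n) :
  posdef A -> posdef B -> posdef M -> \tr A = 2 -> \tr B = 2 -> effect P ->
  A + B = M + M ->
  entropy M <= (entropy A + entropy B) / 2 - Re (\tr ((A - B) *m P)) ^+ 2 / 32.
Proof.
move=> pA pB pM tA tB eP EM.
have tM : \tr M = 2.
  have : \tr M + \tr M = 2 + 2 by rewrite -linearD -EM linearD /= tA tB.
  rewrite -!mulr2n => /eqP; rewrite -subr_eq0 -mulrnBl mulrn_eq0 /= subr_eq0.
  by move/eqP.
have := divergence_ge pA pM tA tM eP; have := divergence_ge pB pM tB tM eP.
have EB : B - M = - (A - M).
  by rewrite opprB; apply/eqP; rewrite subr_eq addrAC eq_sym subr_eq addrC EM.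
(* A - M is half of A - B, which turns the constant 8 of [divergence_ge] into 32. *)
have EAB : A - B = (A - M) + (A - M) by rewrite -{2}[A - M]opprK -EB opprB addrA subrK.
rewrite EB EAB; move: (A - M) => X.
rewrite mulmxN mulNmx mulmxDl !linearN linearD /= ReD.
have ReN (z : Cplx) : Re (- z) = - Re z by case: z.
rewrite ?ReN !expr2; lra.
Qed.

(** * The regularized entropy of states and of their mixtures *)

(* The shift by 1/n bounds the eigenvalues away from 0, where ln is a junk value. *)
Definition regularize n (rho : 'M[Cplx]_n) : 'M[Cplx]_n :=
  rho + ((n%:R^-1 : Real)%:C)%C *: 1%:M.

Definition regentropy n (rho : 'M[Cplx]_n) : Real := entropy (regularize rho).

Lemma psdmx_regularize n (rho : 'M[Cplx]_n) : psdmx rho -> psdmx (regularize rho).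
Proof.
move=> p; apply: (psdmxD p); apply: psdmxZ (psdmx1 n).
by rewrite invr_ge0 ler0n.
Qed.

(** In the eigenbasis of [regularize rho], each eigenvalue is a diagonal entry of rho, which is
    nonnegative, plus 1/n. *)
Lemma posdef_regularize n (rho : 'M[Cplx]_n) :
  (0 < n)%N -> psdmx rho -> posdef (regularize rho).
Proof.
move=> n0 p; have pr := psdmx_regularize p; split=> // i.
have := psdmx_diag_ge0 i (psdmx_congr (spectralmx (regularize rho)) p).
have := spectral_dgmx pr.1; have [UU _] := adj_spectralmx (regularize rho).
set U := spectralmx _ in UU *.
rewrite {1}/regularize mulmxDr mulmxDl -scalemxAr mulmx1 -scalemxAl UU.
move: (U *m rho *m adjmx U) => X /matrixP/(_ i i).
rewrite /dgmx !mxE eqxx !mulr1n mulr1 => E; rewrite lecE => /andP[_ /= H].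
move/(congr1 (@complex.Re _)): E; rewrite ReD /= => <-.
by apply: ltr_wpDl => //; rewrite invr_gt0 ltr0n.
Qed.

Lemma mxtrace_regularize n (rho : 'M[Cplx]_n) :
  (0 < n)%N -> density rho -> \tr (regularize rho) = 2.
Proof.
move=> n0 [_ t]; rewrite /regularize linearD /= t linearZ /= mxtrace1.
have -> : n%:R = (n%:R : Real)%:C%C :> Cplx by rewrite rmorph_nat.
by rewrite -rmorphM /= mulVf ?rmorph1 -?natrD // pnatr_eq0 -lt0n.
Qed.

Lemma sum_eigval_regularize n (rho : 'M[Cplx]_n) :
  (0 < n)%N -> density rho -> \sum_i eigval (regularize rho) i = 2.
Proof.
move=> n0 d; apply: complexI; rewrite -mxtrace_eigval; last exact: (psdmx_regularize d.1).1.
by rewrite mxtrace_regularize // rmorph_nat.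
Qed.

(** Each eigenvalue is at most their sum 2, so x ln x <= x ln 2. *)
Lemma regentropy_le n (rho : 'M[Cplx]_n) :
  (0 < n)%N -> density rho -> regentropy rho <= 2 * ln 2.
Proof.
move=> n0 d; have [_ a0] := posdef_regularize n0 d.1.
rewrite -(sum_eigval_regularize n0 d) mulr_suml ler_sum // => i _.
rewrite /xlnx ler_pM2l // ln_le //.
rewrite (bigD1 i) //= lerDl sumr_ge0 // => j _.
exact: ltW.
Qed.

Lemma regentropy_ge n (rho : 'M[Cplx]_n) :
  (0 < n)%N -> density rho -> 2 * ln 2 - 2 * ln n%:R <= regentropy rho.
Proof.
move=> n0 d; have [_ a0] := posdef_regularize n0 d.1.
have n0' : 0 < n%:R :> Real by rewrite ltr0n.
(* The average eigenvalue: in the tangent bound at c the terms a - c sum to 0, leaving 2 ln c. *)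
pose c : Real := 2 / n%:R; have c0 : 0 < c by rewrite divr_gt0.
have : \sum_i (eigval (regularize rho) i * ln c + eigval (regularize rho) i - c)
   <= regentropy rho.
  by apply: ler_sum => i _; apply: xlnx_ge_tangent.
rewrite sumrB big_split /= -mulr_suml sum_eigval_regularize //.
rewrite sumr_const card_ord -[c *+ n]mulr_natr divfK ?gt_eqF //.
rewrite /c lnRM ?invr_gt0 // lnRV //; lra.
Qed.

Definition mixture n (rho sigma : 'M[Cplx]_n) : 'M[Cplx]_n :=
  ((2^-1 : Real)%:C)%C *: (rho + sigma).

Lemma mixture_dbl n (rho sigma : 'M[Cplx]_n) :
  mixture rho sigma + mixture rho sigma = rho + sigma.
Proof.
rewrite /mixture -scalerDl -rmorphD /=.
by have -> : 2^-1 + 2^-1 = 1 :> Real by [lra]; rewrite scale1r.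
Qed.

Lemma density_mixture n (rho sigma : 'M[Cplx]_n) :
  density rho -> density sigma -> density (mixture rho sigma).
Proof.
move=> [p t] [q u]; split.
  by apply: psdmxZ; [rewrite invr_ge0 ler0n | apply: psdmxD].
rewrite linearZ linearD /= t u.
have -> : 1 + 1 = (2 : Real)%:C%C :> Cplx by rewrite rmorph_nat.
by rewrite -rmorphM /= mulVf ?rmorph1 // pnatr_eq0.
Qed.

Lemma regentropy_mixture n (rho sigma P : 'M[Cplx]_n) :
  (0 < n)%N -> density rho -> density sigma -> effect P ->
  regentropy (mixture rho sigma) <= (regentropy rho + regentropy sigma) / 2
    - Re (\tr ((rho - sigma) *m P)) ^+ 2 / 32.
Proof.
move=> n0 dr ds eP; have dm := density_mixture dr ds.
have -> : rho - sigma = regularize rho - regularize sigma.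
  by rewrite /regularize opprD addrACA subrr addr0.
apply: entropy_midpoint => //; try exact: posdef_regularize n0 (proj1 _).
- by apply: posdef_regularize => //; case: dr.
- by apply: posdef_regularize => //; case: ds.
- by apply: posdef_regularize => //; case: dm.
- exact: mxtrace_regularize.
- exact: mxtrace_regularize.
by rewrite /regularize addrACA [RHS]addrACA mixture_dbl.
Qed.

(** * Hypothesis states and the mistake bound *)

(** This replaces compactness: without a near-minimizer, F could be lowered by eps again and again,
    and would pass below lo after finitely many steps. *)
Lemma exists_near_min (T : Type) (K : T -> Prop) (F : T -> Real) (lo eps : Real) :
  0 < eps -> (exists x, K x) -> (forall x, K x -> lo <= F x) ->
  exists x, K x /\ forall y, K y -> F x <= F y + eps.
Proof.
move=> e0 [x0 K0] Klo; apply: contrapT => none.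
have down n : exists x, K x /\ F x + n%:R * eps <= F x0.
  elim: n => [|n [x [Kx Fx]]]; first by exists x0; rewrite mul0r addr0.
  apply: contrapT => H; apply: none; exists x; split=> // y Ky.
  rewrite leNgt; apply/negP => lt; apply: H; exists y; split=> //.
  rewrite -addn1 natrD; lra.
have := truncnS_gt ((F x0 - lo) / eps); set n := _.+1 => Hn.
have [x [Kx]] := down n; have := Klo _ Kx; move: Hn; rewrite ltr_pdivrMr //; lra.
Qed.

Section MistakeBound.

Variables (N M k : nat) (Z : {set bits N * bits M}) (f : bits N -> bits M -> bool).
Variables (rho : bits N -> 'M[Cplx]_(2 ^ k)) (E : bits M -> bool -> 'M[Cplx]_(2 ^ k)).
Hypothesis rho_density : forall x, density (rho x).
Hypothesis E_povm : forall y, povm (E y).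
Hypothesis E_correct :
  forall x y, (x, y) \in Z -> (2 / 3 : Cplx) <= \tr (E y (f x y) *m rho x).

Let dim_gt0 : (0 < 2 ^ k)%N. Proof. by rewrite expn_gt0. Qed.

Definition consistent (L : seq (bits M * bool)) (sigma : 'M[Cplx]_(2 ^ k)) :=
  density sigma /\
  forall c, c \in L -> 2 / 3 <= Re (\tr (E c.1 c.2 *m sigma)).

Definition labelled (x : bits N) (L : seq (bits M * bool)) :=
  forall c, c \in L -> (x, c.1) \in Z /\ c.2 = f x c.1.

Let E_effect y b : effect (E y b).
Proof.
have [pE sE] := E_povm y; split=> //.
have -> : 1%:M - E y b = E y (~~ b); last exact: pE.
by rewrite -sE; case: b; rewrite ?addrK // addrAC subrr add0r.
Qed.

Let consistent_rho x L : labelled x L -> consistent L (rho x).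
Proof.
move=> xL; split=> // c /xL[Zc ->].
have := le_Re (E_correct Zc); apply: le_trans.
by rewrite -[2 / 3 : Real]/(Re (2 / 3)%:C%C) rmorphM rmorphV ?unitfE ?pnatr_eq0 // !rmorph_nat.
Qed.

(* The hypothesis depends on L alone, so Bob can compute it from the message. *)
Lemma exists_hypothesis : exists h : seq (bits M * bool) -> 'M[Cplx]_(2 ^ k),
  forall L, (exists sigma, consistent L sigma) -> consistent L (h L) /\
    forall tau, consistent L tau -> regentropy (h L) <= regentropy tau + 1 / 2304.
Proof.
pose good L s := (exists sigma, consistent L sigma) -> consistent L s /\
  forall tau, consistent L tau -> regentropy s <= regentropy tau + 1 / 2304.
suff /choice[h hP] : forall L, exists s, good L s by exists h.
move=> L; rewrite /good.
(* If no state fits L the requirement is vacuous and 0 is a dummy value. *)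
have [ne|no] := pselect (exists sigma, consistent L sigma); last by exists 0.
have e0 : 0 < 1 / 2304 :> Real by lra.
have lo s : consistent L s -> 2 * ln 2 - 2 * ln (2 ^ k)%:R <= regentropy s.
  by case=> ds _; apply: regentropy_ge.
have [s [Ks Hs]] := exists_near_min e0 ne lo.
by exists s.
Qed.

Variable h : seq (bits M * bool) -> 'M[Cplx]_(2 ^ k).
Hypothesis hP : forall L, (exists sigma, consistent L sigma) -> consistent L (h L) /\
    forall tau, consistent L tau -> regentropy (h L) <= regentropy tau + 1 / 2304.

Definition predict L y : bool := 1 / 2 <= Re (\tr (E y true *m h L)).

(** On [E y (f x y)] the old and new hypotheses differ by at least 2/3 - 1/2 = 1/6, so their
    midpoint lies (1/6)^2/32 = 1/1152 below the average potential. The slack 1/2304 in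
    near-minimality costs half of that, and passing from the average to the new potential doubles
    the rest. *)
Lemma mistake_gain x L y : labelled x L -> (x, y) \in Z -> predict L y != f x y ->
  regentropy (h L) + 1 / 1152 <= regentropy (h ((y, f x y) :: L)).
Proof.
move=> xL Zy wrong; set L' := _ :: L.
have xL' : labelled x L' by move=> c; rewrite inE => /orP[/eqP-> //|/xL].
have [[dL cL] minL] := hP (ex_intro _ _ (consistent_rho xL)).
have [[dL' cL'] _] := hP (ex_intro _ _ (consistent_rho xL')).
have hi : 2 / 3 <= Re (\tr (E y (f x y) *m h L')).
  by apply: (cL' (y, f x y)); rewrite inE eqxx.
have lo : Re (\tr (E y (f x y) *m h L)) <= 1 / 2.
  have sum1 : Re (\tr (E y false *m h L)) + Re (\tr (E y true *m h L)) = 1.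
    by rewrite -ReD -linearD -mulmxDl (E_povm y).2 mul1mx /= dL.2.
  move: wrong sum1; rewrite /predict.
  by case: (f x y); move: (Re _) (Re _) => u v; case: leP => //; lra.
(* The constraints are linear in the state, so the midpoint is a competitor of [h L]. *)
have cm : consistent L (mixture (h L) (h L')).
  split=> [|c Lc]; first exact: density_mixture.
  rewrite /mixture -scalemxAr linearZ /= Re_scale mulmxDr linearD /= ReD.
  have := cL c Lc; have : 2 / 3 <= Re (\tr (E c.1 c.2 *m h L')).
    by apply: cL'; rewrite inE Lc orbT.
  move: (Re _) (Re _) => u v; lra.
have := regentropy_mixture dim_gt0 dL dL' (E_effect y (f x y)).
rewrite mulmxBl linearB /= ReB [\tr (h L *m _)]mxtrace_mulC [\tr (h L' *m _)]mxtrace_mulC.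
have := minL _ cm; move: lo hi.
move: (Re _) (Re _) (regentropy _) (regentropy _) (regentropy _) => u v p q r.
rewrite expr2; nra.
Qed.

(** Greedy construction: as long as some input is mispredicted, add it to the list. The bounded
    potential stops this. *)
Lemma exists_teaching_seq x :
  exists L, (size L <= 2304 * k)%N /\ forall y, (x, y) \in Z -> predict L y = f x y.
Proof.
apply: contrapT => none.
pose base : Real := 2 * ln 2 - 2 * ln (2 ^ k)%:R.
have grow t : (t <= (2304 * k).+1)%N -> exists L, [/\ size L = t, labelled x L &
    base + t%:R / 1152 <= regentropy (h L)].
  elim: t => [_|t IH lt].
    exists [::]; split=> //; rewrite mul0r addr0; apply: regentropy_ge => //.
    have x0 : labelled x [::] by [].
    by have [[]] := hP (ex_intro _ _ (consistent_rho x0)).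
  have [L [sL xL gL]] := IH (ltnW lt).
  have [y Zy wrong] : exists2 y, (x, y) \in Z & predict L y != f x y.
    apply: contrapT => H; apply: none; exists L; split; first by rewrite sL.
    by move=> y Zy; apply/eqP/negP => ne; apply: H; exists y => //; apply/negP.
  exists ((y, f x y) :: L); split; first by rewrite /= sL.
    by move=> c; rewrite inE => /orP[/eqP-> //|/xL].
  by apply: le_trans (mistake_gain xL Zy wrong); rewrite -natr1 mulrDl addrA lerD2r.
(* After 2304 k + 1 mistakes the gain exceeds 2304 k / 1152 = 2 k, whereas the range 2 ln (2^k) is
   at most 2 k. *)
have [L [_ xL gL]] := grow _ (leqnn _).
have [[dL _] _] := hP (ex_intro _ _ (consistent_rho xL)).
have := ln_pow2_le k; have := le_trans gL (regentropy_le dim_gt0 dL).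
rewrite /base -[(2304 * k).+1%:R]natr1 natrM; lra.
Qed.

End MistakeBound.

(** * Encoding the list of mistakes as a classical message *)

Lemma card_bits n : #|{: bits n}| = (2 ^ n)%N.
Proof. by rewrite card_ffun card_bool card_ord. Qed.

Lemma deterministic_R1_protocol (N M k : nat) (Z : {set bits N * bits M})
    (f : bits N -> bits M -> bool) (A : finType) (dec : A -> bits M -> bool) :
  (#|A| <= 2 ^ k)%N ->
  (forall x, exists m, forall y, (x, y) \in Z -> dec m y = f x y) ->
  R1_protocol Z f k.
Proof.
rewrite -card_bits => leA /choice[enc encP].
pose g (a : A) : bits k := enum_val (widen_ord leA (enum_rank a)).
have g_inj : injective g.
  by move=> a b /enum_val_inj/(congr1 val)/= /val_inj/enum_rank_inj.
exists (fun x m => (m == g (enc x))%:R).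
(* Strings outside the image of [g] have probability 0; [false] is a default there. *)
exists (fun m y => if [pick a | g a == m] is Some a then dec a y else false).
split=> [x|x y Zxy].
  split=> [m|]; first exact: ler0n.
  by rewrite (bigD1 (g (enc x))) //= eqxx big1 ?addr0 // => m /negbTE->.
rewrite (bigD1 (g (enc x))) /=; last first.
  case: pickP => [a /eqP/g_inj->|/(_ (enc x))]; first by rewrite encP.
  by rewrite eqxx.
rewrite eqxx big1 ?addr0 => [|m /andP[_ /negbTE->]] //.
have -> : true%:R = 1 :> Real by [].
lra.
Qed.

(** With p = 2^M >= 2, one slot takes 2 p + 1 <= p^3 values, hence fits in 3 M bits. *)
Lemma card_message_le (M T : nat) : (0 < M)%N ->
  (#|{: T.-tuple (option (bits M * bool))}| <= 2 ^ (3 * M * T))%N.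
Proof.
move=> M0; rewrite card_tuple card_option card_prod card_bits card_bool expnM.
case: T => [|T] //; rewrite leq_exp2r //.
have : (1 < 2 ^ M)%N by rewrite (ltn_exp2l 0).
rewrite [(3 * M)%N]mulnC expnM; move: (2 ^ M)%N => p p1.
by rewrite !expnS expn0 muln1; nia.
Qed.

(** [None] fills shorter lists up to the fixed length T, so that all messages share one finite
    type. *)
Lemma pad_seq (T : nat) (X : Type) (L : seq X) : (size L <= T)%N ->
  exists m : T.-tuple (option X), pmap id m = L.
Proof.
move=> sL; have sm : size (map Some L ++ nseq (T - size L) None) == T.
  by rewrite size_cat size_map size_nseq subnKC.
exists (Tuple sm) => /=; rewrite pmap_cat.
have -> : pmap id (nseq (T - size L) (@None X)) = [::] by elim: (T - size L)%N.
by rewrite cats0; elim: L {sL sm} => //= a L ->.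
Qed.

Lemma Q1_protocol_R1_protocol (N M k : nat) (Z : {set bits N * bits M})
    (f : bits N -> bits M -> bool) :
  (0 < M)%N -> Q1_protocol Z f k -> R1_protocol Z f (3 * M * (2304 * k)).
Proof.
move=> M0 [rho [E [dens [povmE correct]]]].
have [h hP] := exists_hypothesis E.
apply: (@deterministic_R1_protocol _ _ _ _ _ _
  (fun m : (2304 * k).-tuple (option (bits M * bool)) => predict E h (pmap id m))).
  exact: card_message_le.
move=> x; have [L [sL okL]] := exists_teaching_seq dens povmE correct hP x.
by have [m mL] := pad_seq sL; exists m; rewrite mL.
Qed.

(** * The trivial quantum protocol and the final bound *)

Lemma psdmx_dgmx n (a : 'I_n -> Real) : (forall i, 0 <= a i) -> psdmx (dgmx a).
Proof.
move=> a0; split.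
  apply/matrixP=> i j; rewrite /dgmx !mxE eq_sym; case: eqP => [->|_].
    by rewrite !mulr1n; apply/CrealP/complex_realP; exists (a j).
  by rewrite !mulr0n rmorph0.
move=> v; rewrite mxE sumr_ge0 // => i _; rewrite /dgmx mul_mx_diag !mxE.
by rewrite mulrAC mulr_ge0 ?ler0c // mulrC mul_conjC_ge0.
Qed.

Lemma mxtrace_dgmx n (a : 'I_n -> Real) : \tr (dgmx a) = (\sum_i a i)%:C%C.
Proof.
by rewrite /dgmx mxtrace_diag rmorph_sum; apply: eq_bigr => i _; rewrite mxE.
Qed.

(** Alice sends x as a basis state and Bob reads it off. Hence the default value 0 in [Q1] is never
    taken. *)
Lemma classical_Q1_protocol (N M : nat) (Z : {set bits N * bits M})
    (f : bits N -> bits M -> bool) : Q1_protocol Z f N.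
Proof.
pose e (x : bits N) : 'I_(2 ^ N) := cast_ord (card_bits N) (enum_rank x).
pose d (i : 'I_(2 ^ N)) : bits N := enum_val (cast_ord (esym (card_bits N)) i).
have eK : cancel e d by move=> x; rewrite /d /e cast_ordK enum_rankK.
exists (fun x => dgmx (fun i => (i == e x)%:R)).
exists (fun y b => dgmx (fun i => (f (d i) y == b)%:R)).
split=> [x|]; last split=> [y|x y _].
- split; first by apply: psdmx_dgmx => i; apply: ler0n.
  rewrite mxtrace_dgmx (bigD1 (e x)) //= eqxx big1 ?addr0 ?rmorph1 //.
  by move=> i /negbTE->.
- split; first by move=> b; apply: psdmx_dgmx => i; apply: ler0n.
  apply/matrixP=> i j; rewrite /dgmx !mxE; case: (i == j); last by rewrite !mulr0n addr0.
  by rewrite !mulr1n -rmorphD /=; case: (f _ _); rewrite ?addr0 ?add0r rmorph1.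
rewrite /mxtrace (bigD1 (e x)) //= big1 => [|i /negbTE ne]; last first.
  by rewrite mul_dgmx /dgmx !mxE ne mul0rn mulr0.
rewrite mul_dgmx /dgmx !mxE !eqxx eK eqxx mulr1n addr0 rmorph1 mulr1.
by rewrite ler_pdivrMr ?ltr0n // mul1r ler_nat.
Qed.

Theorem theorem4 :
  exists C : Real, 0 < C /\
    forall (N M : nat), (0 < N)%N -> (0 < M)%N ->
    forall (Z : {set bits N * bits M}) (f : bits N -> bits M -> bool),
      (R1 Z f)%:R <= C * M%:R * (Q1 Z f)%:R.
Proof.
(* 6912 = 3 * 2304: at most 2304 k list entries of 3 M bits each. *)
exists 6912; split=> [|N M _ M0 Z f]; first by rewrite ltr0n.
have QP : Q1_protocol Z f (Q1 Z f).
  rewrite /Q1; case: pselect => [ex|[]]; first by case: ex_minnP => k /asboolP.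
  by exists N; apply/asboolP/classical_Q1_protocol.
have RP := Q1_protocol_R1_protocol M0 QP.
have le : (R1 Z f <= 3 * M * (2304 * Q1 Z f))%N.
  rewrite /R1; case: pselect => [ex|//]; case: ex_minnP => k _; apply.
  exact/asboolP.
move: le; rewrite -(ler_nat Real) !natrM => le.
apply: le_trans le _; rewrite le_eqVlt; apply/orP; left; apply/eqP; ring.
Qed.
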